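(* For integers $m\ge1$ let $\kappa_{2m}=\frac{2(3m-1)^3}{27(2m-1)}$ and $\kappa_{2m-1}=\frac{2(3m-2)^3}{27(2m-1)}$. If $x\in\mathbb{C}$ with $\Re(x)>0$, then $$\frac{\Gamma^3\left(\frac12\left(x+\frac23\right)\right)}{\Gamma^3\left(\frac12\left(x+\frac43\right)\right)}=\cfrac{1}{x/2+\mathbf{K}_{m=1}^{\infty}\left(\frac{\kappa_m}{x}\right)}.$$
   Context: For complex sequences $(a_n)_{n\ge1}$, $(b_n)_{n\ge0}$, the continued fraction $b_0+\mathbf{K}_{n=1}^{\infty}\left(\frac{a_n}{b_n}\right)=b_0+\cfrac{a_1}{b_1+\cfrac{a_2}{b_2+\cdots}}$ is defined as the limit as $n\to\infty$ of its $n$th approximant $b_0+\mathbf{K}_{k=1}^{n}\left(\frac{a_k}{b_k}\right)=b_0+\cfrac{a_1}{b_1+\cfrac{a_2}{\ddots+\cfrac{a_n}{b_n}}}$. The notation $\cfrac{a_0}{b_0+\mathbf{K}_{m=1}^{\infty}\left(\frac{a_m}{b_m}\right)}$ means $a_0$ divided by $b_0+\mathbf{K}_{m=1}^{\infty}\left(\frac{a_m}{b_m}\right)$. $\Gamma$ is the Gamma function and $\Gamma^3(z)=(\Gamma(z))^3$. *)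

(* Defs.v *)
From Stdlib Require Import Reals Factorial Lia PeanoNat.
From Coquelicot Require Export Coquelicot.

Local Open Scope C_scope.

Definition is_Clim_seq (u : nat -> C) (l : C) : Prop :=
  filterlim u eventually (locally l).

(* Total, like [Lim_seq]: the value is meaningless if [u] diverges. *)
Definition Clim_seq (u : nat -> C) : C :=
  (real (Lim_seq (fun n => Re (u n))), real (Lim_seq (fun n => Im (u n)))).

Definition Cexp (z : C) : C :=
  (exp (Re z) * cos (Im z), exp (Re z) * sin (Im z))%R.

Fixpoint rising (z : C) (n : nat) : C :=
  match n with
  | O => 1
  | S n' => rising z n' * (z + INR n')
  end.

(* The Gamma function as Euler defined it,
     Gamma z = lim  n! n^z / (z (z + 1) ... (z + n)),
   for every complex z other than 0, -1, -2, ..., with n^z = exp (z ln n).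
   At the poles the value is meaningless. *)
Definition Gamma_seq (z : C) (n : nat) : C :=
  INR (fact n) * Cexp (z * ln (INR n)) / rising z (S n).

Definition Gamma (z : C) : C := Clim_seq (Gamma_seq z).

(* a_k / (b_k + a_(k+1) / (b_(k+1) + ... + a_(k+n-1) / b_(k+n-1))), n levels.
   Division is total; if no denominator b_j + ... vanishes (for instance if
   every a_j is a positive real and every b_j is the same x with Re x > 0),
   this is the usual finite continued fraction. *)
Fixpoint Kfrac (a b : nat -> C) (k n : nat) : C :=
  match n with
  | O => 0
  | S n' => a k / (b k + Kfrac a b (S k) n')
  end.

(* b_0 + K_{n >= 1} (a_n / b_n) converges to l; a_0 is not used. *)
Definition is_cfrac (a b : nat -> C) (l : C) : Prop :=
  is_Clim_seq (fun n => b 0%nat + Kfrac a b 1 n) l.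

(* [Nat.div2 (S n)] is m both for n = 2m and for n = 2m - 1; the value at 0
   is not used. *)
Definition kappa (n : nat) : R :=
  let m := INR (Nat.div2 (S n)) in
  (if Nat.even n
   then 2 * (3 * m - 1) ^ 3 / (27 * (2 * m - 1))
   else 2 * (3 * m - 2) ^ 3 / (27 * (2 * m - 1)))%R.

Lemma kappa_even (m : nat) : (1 <= m)%nat ->
  kappa (2 * m) = (2 * (3 * INR m - 1) ^ 3 / (27 * (2 * INR m - 1)))%R.
Proof.
intros _; unfold kappa.
now rewrite Nat.div2_succ_double, Nat.even_even.
Qed.

Lemma kappa_odd (m : nat) : (1 <= m)%nat ->
  kappa (2 * m - 1) = (2 * (3 * INR m - 2) ^ 3 / (27 * (2 * INR m - 1)))%R.
Proof.
intros Hm; unfold kappa.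
replace (S (2 * m - 1)) with (2 * m)%nat by lia.
replace (2 * m - 1)%nat with (2 * (m - 1) + 1)%nat by lia.
now rewrite Nat.div2_double, Nat.even_odd.
Qed.

(* Main.v *)
Require Import Defs.
From Stdlib Require Import Reals Factorial Lra Lia.
From Coquelicot Require Import Coquelicot.

Local Open Scope C_scope.

(** Write [L x] for the value of [x/2 + K(kappa_m / x)].  The theorem follows from
    three facts about it, valid for [Re x > 0].

    - The fraction converges, and it may be evaluated with any tails in the
      closed right half-plane ([cf_uniform_limit]).  Each step
      [w |-> kappa_m / (x + w)] maps that half-plane into itself, so its images
      under the partial compositions are nested discs; their radii tend to 0
      because [kappa_m <= m^2], so that the sum of [1 / sqrt kappa_m] diverges.

    - [(3x+2)^3 L(x+2) = (3x+4)^3 L(x)] ([kappa_cf_functional]).  There are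
      2 x 2 matrices [N_n], with entries polynomial in [x], such that
      [N_n T_n(x) = T_n(x+2) N_(n+1)], where [T_n(x)] is the matrix of
      [w |-> kappa_n / (x + w)].  Hence [N_1] sends the approximant of the
      fraction at [x] with tail [w] to the approximant at [x+2] with tail
      [N_(n+1) w].  The tail which [N_(n+1)] sends to 0 is about [n/2]: it
      lies in the right half-plane for large [n], so both sides converge, and
      [N_1] is the functional equation.

    - [L(x) - x/2] is bounded on each half-plane [Re x >= r > 0]
      ([kappa_cf_bound]), hence [L(x + 2n) / n] tends to 1.

    With [z = (x + 2/3)/2] and [w = (x + 4/3)/2] the factors of the functional
    equation are [6z] and [6w], so iterating it gives
    [L(x + 2n) = L(x) ((w)_n / (z)_n)^3] in rising factorials.  Up to the
    factor [n], this is the cube of the quotient of the sequences whose limits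
    define [Gamma z] and [Gamma w]: since [w - z = 1/3], the powers of [n]
    contribute exactly [1/n].  It remains to know that these sequences
    converge to nonzero limits ([is_Clim_seq_Gamma]). *)

(** * Limits of complex sequences *)

(** Trades the product uniform structure of the plane for the modulus, which is
    multiplicative. *)
Lemma is_Clim_seq_Cmod (u : nat -> C) (l : C) :
  is_Clim_seq u l <-> is_lim_seq (fun n => Cmod (u n - l)) 0.
Proof.
unfold is_Clim_seq; split; intro H.
- apply is_lim_seq_spec; intro eps.
  assert (He : (0 < eps / 2)%R) by (destruct eps; simpl; lra).
  pose proof (proj1 (filterlim_locally u l) H (mkposreal _ He)) as H'.
  apply filter_imp with (2 := H'); intros n [H1 H2].
  change (Rabs (fst (u n) - fst l) < eps / 2)%R in H1.
  change (Rabs (snd (u n) - snd l) < eps / 2)%R in H2.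
  rewrite Rminus_0_r, Rabs_pos_eq by apply Cmod_ge_0.
  replace (u n - l) with (RtoC (fst (u n) - fst l) + RtoC (snd (u n) - snd l) * Ci)
    by (apply injective_projections; simpl; ring).
  eapply Rle_lt_trans; [ apply Cmod_triangle | ].
  rewrite Cmod_mult, Cmod_Ci, !Cmod_R; lra.
- apply filterlim_locally; intro eps.
  pose proof (proj2 (is_lim_seq_spec _ _) H eps) as H'.
  apply filter_imp with (2 := H'); intros n Hn.
  rewrite Rminus_0_r, Rabs_pos_eq in Hn by apply Cmod_ge_0.
  pose proof (Rmax_Cmod (u n - l)) as Hm.
  split.
  + change (Rabs (fst (u n) - fst l) < eps)%R.
    eapply Rle_lt_trans; [ | exact Hn ]; eapply Rle_trans; [ | exact Hm ].
    apply Rmax_l.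
  + change (Rabs (snd (u n) - snd l) < eps)%R.
    eapply Rle_lt_trans; [ | exact Hn ]; eapply Rle_trans; [ | exact Hm ].
    apply Rmax_r.
Qed.

Lemma is_Clim_seq_le (u : nat -> C) (l : C) (e : nat -> R) :
  is_lim_seq e 0 -> eventually (fun n => (Cmod (u n - l) <= e n)%R) ->
  is_Clim_seq u l.
Proof.
intros He H; apply is_Clim_seq_Cmod.
apply is_lim_seq_le_le_loc with (fun _ => 0%R) e; [ | apply is_lim_seq_const | exact He ].
apply filter_imp with (2 := H); intros n Hn; split; [ apply Cmod_ge_0 | exact Hn ].
Qed.

Lemma is_Clim_seq_const (l : C) : is_Clim_seq (fun _ => l) l.
Proof. apply filterlim_const. Qed.

Lemma is_Clim_seq_ext_loc (u v : nat -> C) (l : C) :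
  eventually (fun n => u n = v n) -> is_Clim_seq u l -> is_Clim_seq v l.
Proof. intros H; apply filterlim_ext_loc; exact H. Qed.

Lemma is_Clim_seq_plus (u v : nat -> C) (l m : C) :
  is_Clim_seq u l -> is_Clim_seq v m -> is_Clim_seq (fun n => u n + v n) (l + m).
Proof.
intros Hu Hv.
apply is_Clim_seq_Cmod in Hu; apply is_Clim_seq_Cmod in Hv.
apply is_Clim_seq_le with (fun n => Cmod (u n - l) + Cmod (v n - m))%R.
- replace (Finite 0) with (Finite (0 + 0)) by (f_equal; ring).
  apply is_lim_seq_plus'; assumption.
- exists 0%nat; intros n _.
  replace (u n + v n - (l + m)) with ((u n - l) + (v n - m)) by ring.
  apply Cmod_triangle.
Qed.

Lemma is_Clim_seq_mult (u v : nat -> C) (l m : C) :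
  is_Clim_seq u l -> is_Clim_seq v m -> is_Clim_seq (fun n => u n * v n) (l * m).
Proof.
intros Hu Hv.
apply is_Clim_seq_Cmod in Hu; apply is_Clim_seq_Cmod in Hv.
apply is_Clim_seq_le with
  (fun n => Cmod (u n - l) * Cmod (v n - m) + Cmod (u n - l) * Cmod m
            + Cmod l * Cmod (v n - m))%R.
- replace (Finite 0) with (Finite (0 * 0 + 0 * Cmod m + Cmod l * 0)) by (f_equal; ring).
  repeat apply is_lim_seq_plus'; apply is_lim_seq_mult'; try assumption;
    apply is_lim_seq_const.
- exists 0%nat; intros n _.
  replace (u n * v n - l * m)
    with ((u n - l) * (v n - m) + (u n - l) * m + l * (v n - m)) by ring.
  rewrite <- !Cmod_mult.
  eapply Rle_trans; [ apply Cmod_triangle | ]; apply Rplus_le_compat_r, Cmod_triangle.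
Qed.

Lemma is_Clim_seq_inv (u : nat -> C) (l : C) :
  l <> 0 -> is_Clim_seq u l -> is_Clim_seq (fun n => / u n) (/ l).
Proof.
intros Hl Hu; apply is_Clim_seq_Cmod in Hu.
assert (Hl' : (0 < Cmod l)%R) by now apply Cmod_gt_0.
apply is_Clim_seq_le with (fun n => 2 / (Cmod l * Cmod l) * Cmod (u n - l))%R.
- replace (Finite 0) with (Finite (2 / (Cmod l * Cmod l) * 0)) by (f_equal; ring).
  apply is_lim_seq_mult'; [ apply is_lim_seq_const | exact Hu ].
- assert (He : (0 < Cmod l / 2)%R) by lra.
  pose proof (proj2 (is_lim_seq_spec _ _) Hu (mkposreal _ He)) as H.
  apply filter_imp with (2 := H); simpl; intros n Hn.
  rewrite Rminus_0_r, Rabs_pos_eq in Hn by apply Cmod_ge_0.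
  assert (Hun : (Cmod l / 2 <= Cmod (u n))%R).
  { pose proof (Cmod_triangle (u n) (- (u n - l))) as Ht.
    rewrite Cmod_opp in Ht.
    replace (u n + - (u n - l)) with l in Ht by ring. lra. }
  assert (Hn0 : u n <> 0) by (apply Cmod_gt_0; lra).
  replace (/ u n - / l) with (- ((u n - l) / (u n * l))) by (field; now split).
  rewrite Cmod_opp, Cmod_div, Cmod_mult by now apply Cmult_neq_0.
  unfold Rdiv; rewrite Rmult_comm.
  apply Rmult_le_compat_r; [ apply Cmod_ge_0 | ].
  replace (2 * / (Cmod l * Cmod l))%R with (/ (Cmod l / 2 * Cmod l))%R by (field; lra).
  apply Rinv_le_contravar; [ apply Rmult_lt_0_compat; lra | ].
  apply Rmult_le_compat_r; lra.
Qed.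

Lemma is_Clim_seq_unique (u : nat -> C) (l m : C) :
  is_Clim_seq u l -> is_Clim_seq u m -> l = m.
Proof.
intros Hl Hm.
apply (filterlim_locally_unique (F := eventually) u); assumption.
Qed.

Lemma is_Clim_seq_subseq (u : nat -> C) (l : C) (f : nat -> nat) :
  filterlim f eventually eventually ->
  is_Clim_seq u l -> is_Clim_seq (fun n => u (f n)) l.
Proof. intros Hf Hu; exact (filterlim_comp _ _ _ f u _ _ _ Hf Hu). Qed.

Lemma im_le_Cmod (z : C) : (Rabs (Im z) <= Cmod z)%R.
Proof. eapply Rle_trans; [ apply Rmax_r | apply Rmax_Cmod ]. Qed.

Lemma Re_lipschitz (z w : C) : (Rabs (Re z - Re w) <= Cmod (z - w))%R.
Proof.
eapply Rle_trans; [ | apply re_le_Cmod ].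
unfold Cminus; rewrite re_plus, re_opp; right; f_equal; ring.
Qed.

Lemma Im_lipschitz (z w : C) : (Rabs (Im z - Im w) <= Cmod (z - w))%R.
Proof.
eapply Rle_trans; [ | apply im_le_Cmod ].
unfold Cminus; rewrite im_plus, im_opp; right; f_equal; ring.
Qed.

Lemma Cmod_lipschitz (z w : C) : (Rabs (Cmod z - Cmod w) <= Cmod (z - w))%R.
Proof.
pose proof (Cmod_triangle (z - w) w) as H1; pose proof (Cmod_triangle (- (z - w)) z) as H2.
rewrite Cmod_opp in H2.
replace (z - w + w) with z in H1 by ring; replace (- (z - w) + z) with w in H2 by ring.
apply Rabs_le_between; lra.
Qed.

(** Serves for [Re], [Im] and [Cmod], which carry closed conditions on the terms
    over to the limit. *)
Lemma is_lim_seq_lipschitz (p : C -> R) (u : nat -> C) (l : C) :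
  (forall z w : C, Rabs (p z - p w) <= Cmod (z - w))%R ->
  is_Clim_seq u l -> is_lim_seq (fun n => p (u n)) (p l).
Proof.
intros Hp H; apply is_Clim_seq_Cmod in H; apply is_lim_seq_spec; intro eps.
pose proof (proj2 (is_lim_seq_spec _ _) H eps) as H'.
apply filter_imp with (2 := H'); intros n Hn.
rewrite Rminus_0_r, Rabs_pos_eq in Hn by apply Cmod_ge_0.
eapply Rle_lt_trans; [ apply Hp | exact Hn ].
Qed.

Lemma Clim_seq_eq (u : nat -> C) (l : C) : is_Clim_seq u l -> Clim_seq u = l.
Proof.
intros H; unfold Clim_seq.
rewrite (is_lim_seq_unique _ _ (is_lim_seq_lipschitz Re u l Re_lipschitz H)).
rewrite (is_lim_seq_unique _ _ (is_lim_seq_lipschitz Im u l Im_lipschitz H)).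
destruct l; reflexivity.
Qed.

Lemma ex_Clim_seq_Cauchy (u : nat -> C) (e : nat -> R) :
  is_lim_seq e 0 ->
  (forall n k, Cmod (u (n + k)%nat - u n) <= e n)%R ->
  exists l : C, is_Clim_seq u l /\ forall n, (Cmod (l - u n) <= e n)%R.
Proof.
intros He Hu.
assert (Hc : forall p : C -> R,
  (forall z w : C, Rabs (p z - p w) <= Cmod (z - w))%R ->
  exists l : R, is_lim_seq (fun n => p (u n)) l).
{ intros p Hp; apply ex_lim_seq_cauchy_corr; intro eps.
  assert (Heps : (0 < eps / 2)%R) by (destruct eps; simpl; lra).
  destruct (proj2 (is_lim_seq_spec _ _) He (mkposreal _ Heps)) as [N HN].
  exists N; intros n m Hn Hm.
  assert (H : forall i, (N <= i)%nat -> (Rabs (p (u i) - p (u N)) < eps / 2)%R).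
  { intros i Hi; eapply Rle_lt_trans; [ apply Hp | ].
    replace i with (N + (i - N))%nat by lia.
    eapply Rle_lt_trans; [ apply Hu | ].
    specialize (HN N (le_n N)); simpl in HN; rewrite Rminus_0_r in HN.
    eapply Rle_lt_trans; [ apply Rle_abs | exact HN ]. }
  pose proof (H n Hn) as H1; pose proof (H m Hm) as H2.
  apply Rabs_lt_between in H1; apply Rabs_lt_between in H2.
  apply Rabs_lt_between; lra. }
destruct (Hc Re Re_lipschitz) as [l Hl]; destruct (Hc Im Im_lipschitz) as [m Hm].
assert (Hlim : is_Clim_seq u (l, m)).
{ apply filterlim_locally; intro eps.
  pose proof (proj1 (filterlim_locally _ _) Hl eps) as H1.
  pose proof (proj1 (filterlim_locally _ _) Hm eps) as H2.
  apply filter_imp with (2 := filter_and _ _ H1 H2).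
  intros n Hn; exact Hn. }
exists (l, m); split; [ exact Hlim | intro n ].
apply (is_lim_seq_le_loc (fun k => Cmod (u k - u n)) (fun _ => e n)
  (Cmod ((l, m) - u n)) (e n)); [ | | apply is_lim_seq_const ].
- exists n; intros k Hk; replace k with (n + (k - n))%nat by lia; apply Hu.
- apply (is_lim_seq_lipschitz (fun z => Cmod (z - u n))); [ | exact Hlim ].
  intros z w; eapply Rle_trans; [ apply Cmod_lipschitz | ].
  right; f_equal; ring.
Qed.

(** * Infinite products with factors 1 + O(1/n^2) *)

Lemma is_lim_seq_inv_succ : is_lim_seq (fun n => / INR (S n))%R 0.
Proof.
apply (is_lim_seq_incr_1 (fun n => / INR n)%R).
replace (Finite 0) with (Rbar_inv p_infty) by reflexivity.
apply is_lim_seq_inv; [ apply is_lim_seq_INR | discriminate ].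
Qed.

(** The hypothesis says [|u_(n+1) / u_n - 1| <= a_n - a_(n+1)], but remains
    meaningful where [u] vanishes.  As [1 + t <= exp t], the sequence
    [|u_n| exp(a_n)] decreases, so [u] is bounded; then its increments telescope. *)
Lemma ex_Clim_seq_product (u : nat -> C) (a : nat -> R) :
  (forall n, 0 <= a n)%R ->
  (forall n, Cmod (u (S n) - u n) <= (a n - a (S n)) * Cmod (u n))%R ->
  (forall n, a (S n) <= a n)%R ->
  is_lim_seq a 0 ->
  exists l : C, is_Clim_seq u l.
Proof.
intros Ha Hu Hdec Hlim.
assert (Hbound : forall n, (Cmod (u n) * exp (a n) <= Cmod (u 0%nat) * exp (a 0%nat))%R).
{ induction n as [ | n IH ]; [ lra | ].
  eapply Rle_trans; [ | exact IH ].
  replace (a n) with ((a n - a (S n)) + a (S n))%R by ring.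
  rewrite exp_plus, <- Rmult_assoc.
  apply Rmult_le_compat_r; [ left; apply exp_pos | ].
  pose proof (Cmod_triangle (u n) (u (S n) - u n)) as Ht.
  replace (u n + (u (S n) - u n)) with (u (S n)) in Ht by ring.
  pose proof (exp_ineq1_le (a n - a (S n))) as He.
  pose proof (Rmult_le_compat_l _ _ _ (Cmod_ge_0 (u n)) He).
  specialize (Hu n); lra. }
set (M := (Cmod (u 0%nat) * exp (a 0%nat))%R) in *.
assert (HuM : forall n, (Cmod (u n) <= M)%R).
{ intro n; eapply Rle_trans; [ | apply (Hbound n) ].
  rewrite <- (Rmult_1_r (Cmod (u n))) at 1.
  apply Rmult_le_compat_l; [ apply Cmod_ge_0 | ].
  pose proof (exp_ineq1_le (a n)); specialize (Ha n); lra. }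
assert (HM : (0 <= M)%R) by (eapply Rle_trans; [ apply Cmod_ge_0 | apply (HuM 0%nat) ]).
assert (Htel : forall n k, (Cmod (u (n + k)%nat - u n) <= (a n - a (n + k)%nat) * M)%R).
{ intros n k; induction k as [ | k IH ].
  - rewrite Nat.add_0_r; replace (u n - u n) with (RtoC 0) by ring; rewrite Cmod_0; lra.
  - rewrite Nat.add_succ_r.
    replace (u (S (n + k)) - u n) with ((u (S (n + k)) - u (n + k)%nat) + (u (n + k)%nat - u n))
      by ring.
    eapply Rle_trans; [ apply Cmod_triangle | ].
    assert (Cmod (u (S (n + k)) - u (n + k)%nat) <= (a (n + k)%nat - a (S (n + k))) * M)%R.
    { eapply Rle_trans; [ apply Hu | ].
      apply Rmult_le_compat_l; [ specialize (Hdec (n + k)%nat); lra | apply HuM ]. }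
    lra. }
destruct (ex_Clim_seq_Cauchy u (fun n => a n * M)%R) as [l [Hl _]]; [ | | now exists l ].
- replace (Finite 0) with (Finite (0 * M)) by (f_equal; ring).
  apply is_lim_seq_mult'; [ exact Hlim | apply is_lim_seq_const ].
- intros n k; eapply Rle_trans; [ apply Htel | ].
  apply Rmult_le_compat_r; [ exact HM | specialize (Ha (n + k)%nat); lra ].
Qed.

(** The same bound on the ratios of [1/u] makes [1/u] converge as well, and the two
    limits have product 1. *)
Lemma ex_Clim_seq_product_nonzero (u : nat -> C) (K : R) :
  (forall n, u (S n) <> 0) ->
  (forall n, Cmod (u (S (S n)) / u (S n) - 1) <= K / (INR (S n) * INR (S (S n))))%R ->
  (forall n, Cmod (u (S n) / u (S (S n)) - 1) <= K / (INR (S n) * INR (S (S n))))%R ->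
  exists l : C, l <> 0 /\ is_Clim_seq u l.
Proof.
intros Hu0 Hu Hv.
assert (HK : (0 <= K)%R).
{ pose proof (Rle_trans _ _ _ (Cmod_ge_0 _) (Hu 0%nat)) as H.
  simpl in H; lra. }
set (a := fun n => (K / INR (S n))%R).
assert (Ha : forall n, (0 <= a n)%R).
{ intro n; apply Rdiv_le_0_compat; [ exact HK | apply lt_0_INR; lia ]. }
assert (Hdiff : forall n, (a n - a (S n) = K / (INR (S n) * INR (S (S n))))%R).
{ intro n; unfold a; rewrite (S_INR (S n)).
  pose proof (lt_0_INR (S n) ltac:(lia)); field; lra. }
assert (Hdec : forall n, (a (S n) <= a n)%R).
{ intro n; pose proof (Rle_trans _ _ _ (Cmod_ge_0 _) (Hu n)) as H.
  rewrite <- Hdiff in H; lra. }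
assert (Ha0 : is_lim_seq a 0).
{ replace (Finite 0) with (Rbar_mult K 0) by (simpl; f_equal; ring).
  apply is_lim_seq_scal_l, is_lim_seq_inv_succ. }
destruct (ex_Clim_seq_product (fun n => u (S n)) a) as [l Hl]; auto.
{ intro n; rewrite Hdiff.
  replace (u (S (S n)) - u (S n)) with ((u (S (S n)) / u (S n) - 1) * u (S n))
    by (field; apply Hu0).
  rewrite Cmod_mult; apply Rmult_le_compat_r; [ apply Cmod_ge_0 | apply Hu ]. }
destruct (ex_Clim_seq_product (fun n => / u (S n)) a) as [m Hm]; auto.
{ intro n; rewrite Hdiff.
  replace (/ u (S (S n)) - / u (S n)) with ((u (S n) / u (S (S n)) - 1) * / u (S n))
    by (field; split; apply Hu0).
  rewrite Cmod_mult; apply Rmult_le_compat_r; [ apply Cmod_ge_0 | apply Hv ]. }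
exists l; split.
- intros ->.
  pose proof (is_Clim_seq_mult _ _ _ _ Hl Hm) as H1.
  apply is_Clim_seq_ext_loc with (v := fun _ => RtoC 1) in H1.
  + pose proof (is_Clim_seq_unique _ _ _ H1 (is_Clim_seq_const 1)) as H.
    apply C1_nz; rewrite <- H; ring.
  + exists 0%nat; intros n _; apply Cinv_r, Hu0.
- apply (filterlim_comp _ _ _ pred (fun n => u (S n)) eventually eventually) in Hl.
  + apply is_Clim_seq_ext_loc with (2 := Hl).
    exists 1%nat; intros [ | n] Hn; [ lia | reflexivity ].
  + intros P [N HN]; exists (S N); intros n Hn; apply HN; lia.
Qed.

(** * Convergence of Euler's product for Gamma *)

Lemma exp_mul_1_sub_le (a : R) : (exp a * (1 - a) <= 1)%R.
Proof.
pose proof (exp_ineq1_le (- a)) as H; pose proof (exp_pos a).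
rewrite exp_Ropp in H.
apply Rmult_le_compat_l with (r := exp a) in H; [ | lra ].
rewrite Rinv_r in H by lra; lra.
Qed.

Lemma Rabs_exp_sub_1_le (a : R) : (Rabs (exp a - 1) <= Rabs a * exp (Rabs a))%R.
Proof.
pose proof (exp_ineq1_le a); pose proof (exp_mul_1_sub_le a); pose proof (exp_pos a).
apply Rabs_le_between; unfold Rabs at 1 3; destruct (Rcase_abs a) as [Ha | Ha].
- pose proof (exp_ineq1_le (Rabs a)); pose proof (Rabs_pos a); nra.
- rewrite Rabs_pos_eq by lra; nra.
Qed.

Lemma Rabs_exp_sub_1_sub_le (a : R) : (Rabs (exp a - 1 - a) <= a ^ 2 * exp (Rabs a))%R.
Proof.
pose proof (exp_ineq1_le a); pose proof (exp_mul_1_sub_le a).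
rewrite Rabs_pos_eq by lra.
apply Rle_trans with (a * (exp a - 1))%R; [ lra | ].
eapply Rle_trans; [ apply Rle_abs | ].
rewrite Rabs_mult, <- (pow2_abs a); simpl; rewrite Rmult_1_r, Rmult_assoc.
apply Rmult_le_compat_l; [ apply Rabs_pos | apply Rabs_exp_sub_1_le ].
Qed.

Lemma Rabs_cos_sub_1_le (b : R) : (Rabs (cos b - 1) <= b ^ 2)%R.
Proof.
replace b with (2 * (b / 2))%R at 1 by field.
rewrite cos_2a_sin.
replace (1 - 2 * sin (b / 2) * sin (b / 2) - 1)%R with (- (2 * (sin (b / 2)) ^ 2))%R by ring.
rewrite Rabs_Ropp, Rabs_pos_eq by nra.
assert (Hs : (Rabs (sin (b / 2)) <= Rabs (b / 2))%R).
{ destruct (MVT_gen sin 0 (b / 2) cos) as [c [_ Hc]].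
  - intros; apply is_derive_Reals, derivable_pt_lim_sin.
  - intros; apply continuity_sin.
  - rewrite sin_0, !Rminus_0_r in Hc; rewrite Hc, Rabs_mult.
    pose proof (Rabs_pos (b / 2)).
    pose proof (COS_bound c) as Hb.
    assert (Rabs (cos c) <= 1)%R by (apply Rabs_le_between; lra). nra. }
rewrite <- (pow2_abs (sin _)); pose proof (Rabs_pos (sin (b / 2))).
pose proof (pow_incr _ _ 2 (conj H Hs)) as H2; rewrite (pow2_abs (b / 2)) in H2; nra.
Qed.

Lemma Rabs_sin_sub_le (b : R) : (Rabs (sin b - b) <= Rabs b ^ 3)%R.
Proof.
destruct (MVT_gen (fun t => sin t - t)%R 0 b (fun t => cos t - 1)%R) as [c [Hc1 Hc]].
- intros; auto_derive; [ easy | ring ].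
- intros; apply continuity_minus; [ apply continuity_sin | apply derivable_continuous, derivable_id ].
- rewrite sin_0, !Rminus_0_r in Hc; rewrite Hc, Rabs_mult.
  assert (Hcb : (Rabs c <= Rabs b)%R).
  { revert Hc1; unfold Rmin, Rmax, Rabs; destruct (Rle_dec 0 b), (Rcase_abs c), (Rcase_abs b); lra. }
  pose proof (Rabs_cos_sub_1_le c) as H1.
  pose proof (pow_incr _ _ 2 (conj (Rabs_pos c) Hcb)) as H2.
  rewrite (pow2_abs c) in H2.
  replace (Rabs b ^ 3)%R with (Rabs b ^ 2 * Rabs b)%R by ring.
  apply Rmult_le_compat_r; [ apply Rabs_pos | lra ].
Qed.

Lemma Cexp_plus (z w : C) : Cexp (z + w) = Cexp z * Cexp w.
Proof.
unfold Cexp; rewrite re_plus, im_plus, exp_plus, cos_plus, sin_plus.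
apply injective_projections; simpl; ring.
Qed.

Lemma Cexp_RtoC (a : R) : Cexp (RtoC a) = RtoC (exp a).
Proof.
unfold Cexp; rewrite re_RtoC, im_RtoC, cos_0, sin_0.
apply injective_projections; simpl; ring.
Qed.

Lemma Cexp_pow (z : C) (n : nat) : Cexp z ^ n = Cexp (INR n * z).
Proof.
induction n as [ | n IH ].
- simpl; replace (0 * z) with (RtoC 0) by ring; now rewrite Cexp_RtoC, exp_0.
- rewrite Cpow_S, IH, <- Cexp_plus, S_INR, RtoC_plus; f_equal; ring.
Qed.

Lemma Cmod_Cexp (z : C) : Cmod (Cexp z) = exp (Re z).
Proof.
unfold Cexp, Cmod; simpl fst; simpl snd.
replace ((exp (Re z) * cos (Im z)) ^ 2 + (exp (Re z) * sin (Im z)) ^ 2)%R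
  with ((exp (Re z))² * ((sin (Im z))² + (cos (Im z))²))%R by (unfold Rsqr; ring).
rewrite sin2_cos2, Rmult_1_r; apply sqrt_Rsqr; left; apply exp_pos.
Qed.

Lemma Cexp_neq_0 (z : C) : Cexp z <> 0.
Proof. apply Cmod_gt_0; rewrite Cmod_Cexp; apply exp_pos. Qed.

(** Split [e^(a+ib) - 1 - (a+ib)] as
    [e^a (e^(ib) - 1 - ib) + (e^a - 1 - a) + ib (e^a - 1)]; each part is of second
    order. *)
Lemma Cmod_Cexp_sub_1_sub_le (w : C) (r : R) : (Cmod w <= r)%R ->
  (Cmod (Cexp w - 1 - w) <= (3 + r) * exp r * Cmod w ^ 2)%R.
Proof.
intros Hr.
pose proof (re_le_Cmod w) as Ha; pose proof (im_le_Cmod w) as Hb.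
pose proof (Rabs_exp_sub_1_le (Re w)) as H1.
pose proof (Rabs_exp_sub_1_sub_le (Re w)) as H2.
pose proof (Rabs_cos_sub_1_le (Im w)) as H3.
pose proof (Rabs_sin_sub_le (Im w)) as H4.
rewrite <- pow2_abs in H2, H3.
replace (Cexp w - 1 - w) with
  (RtoC (exp (Re w)) * (RtoC (cos (Im w) - 1) + RtoC (sin (Im w) - Im w) * Ci)
   + RtoC (exp (Re w) - 1 - Re w) + RtoC (Im w) * RtoC (exp (Re w) - 1) * Ci)
  by (unfold Cexp, Re, Im; apply injective_projections; simpl; ring).
eapply Rle_trans; [ apply Cmod_triangle | ].
eapply Rle_trans; [ apply Rplus_le_compat_r, Cmod_triangle | ].
rewrite !Cmod_mult, Cmod_Ci.
assert (H5 : (Cmod (RtoC (cos (Im w) - 1) + RtoC (sin (Im w) - Im w) * Ci)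
   <= Rabs (Im w) ^ 2 + Rabs (Im w) ^ 3)%R).
{ eapply Rle_trans; [ apply Cmod_triangle | ].
  rewrite Cmod_mult, Cmod_Ci, !Cmod_R; lra. }
rewrite !Cmod_R, !Rmult_1_r, (Rabs_pos_eq (exp _)) by (left; apply exp_pos).
assert (He : forall t, (t <= r -> exp t <= exp r)%R).
{ intros t [Ht | ->]; [ left; now apply exp_increasing | lra ]. }
assert (E1 : (exp (Re w) <= exp r)%R).
{ apply He; pose proof (Rle_abs (Re w)); lra. }
assert (E2 : (exp (Rabs (Re w)) <= exp r)%R) by (apply He; lra).
pose proof (exp_pos (Re w)); pose proof (exp_pos r).
pose proof (Rabs_pos (Re w)); pose proof (Rabs_pos (Im w)).
set (a := Rabs (Re w)) in *; set (b := Rabs (Im w)) in *; set (m := Cmod w) in *.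
assert (Hb2 : (b ^ 2 <= m ^ 2)%R) by (apply pow_incr; lra).
assert (Ha2 : (a ^ 2 <= m ^ 2)%R) by (apply pow_incr; lra).
assert (Hb3 : (b ^ 3 <= r * m ^ 2)%R).
{ replace (b ^ 3)%R with (b * b ^ 2)%R by ring.
  apply Rmult_le_compat; try lra; apply pow_le; lra. }
assert (Hab : (b * a <= m ^ 2)%R).
{ simpl; rewrite Rmult_1_r; apply Rmult_le_compat; lra. }
assert (T1 : (exp (Re w) * Cmod (RtoC (cos (Im w) - 1) + RtoC (sin (Im w) - Im w) * Ci)
   <= exp r * (m ^ 2 + r * m ^ 2))%R).
{ apply Rmult_le_compat; try lra; apply Cmod_ge_0. }
assert (T2 : (Rabs (exp (Re w) - 1 - Re w) <= exp r * m ^ 2)%R).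
{ eapply Rle_trans; [ exact H2 | ]; rewrite Rmult_comm.
  apply Rmult_le_compat; try lra; [ left; apply exp_pos | apply pow_le; lra ]. }
assert (T3 : (b * Rabs (exp (Re w) - 1) <= exp r * m ^ 2)%R).
{ eapply Rle_trans; [ apply Rmult_le_compat_l; [ lra | exact H1 ] | ].
  rewrite <- Rmult_assoc, (Rmult_comm (exp r)).
  apply Rmult_le_compat; try lra; [ apply Rmult_le_pos; lra | left; apply exp_pos ]. }
lra.
Qed.

Lemma Re_neq_0 (z : C) : (0 < Re z)%R -> z <> 0.
Proof. intros H ->; simpl in H; lra. Qed.

Lemma INR_neq_0 (n : nat) : RtoC (INR (S n)) <> 0.
Proof. apply Re_neq_0; rewrite re_RtoC; apply lt_0_INR; lia. Qed.

Lemma Re_plus_INR_pos (z : C) (n : nat) : (0 < Re z)%R -> (0 < Re (z + INR n))%R.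
Proof. rewrite re_plus, re_RtoC; pose proof (pos_INR n); lra. Qed.

Lemma rising_neq_0 (z : C) (n : nat) : (0 < Re z)%R -> rising z n <> 0.
Proof.
intro Hz; induction n as [ | n IH ]; [ exact C1_nz | ].
apply Cmult_neq_0; [ exact IH | now apply Re_neq_0, Re_plus_INR_pos ].
Qed.

Lemma Gamma_seq_neq_0 (z : C) (n : nat) : (0 < Re z)%R -> Gamma_seq z n <> 0.
Proof.
intro Hz; unfold Gamma_seq, Cdiv.
assert (Hr : / rising z (S n) <> 0).
{ apply Cmod_gt_0; rewrite Cmod_inv by now apply rising_neq_0.
  apply Rinv_0_lt_compat, Cmod_gt_0, rising_neq_0, Hz. }
repeat apply Cmult_neq_0; [ | apply Cexp_neq_0 | exact Hr ].
apply Re_neq_0; rewrite re_RtoC; apply INR_fact_lt_0.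
Qed.

Lemma Gamma_seq_ratio (z : C) (n : nat) : (0 < Re z)%R ->
  Gamma_seq z n / Gamma_seq z (S n)
  = Cexp (- (z * RtoC (ln (INR (S n)) - ln (INR n)))) * (1 + z / INR (S n)).
Proof.
intro Hz; unfold Gamma_seq.
change (rising z (S (S n))) with (rising z (S n) * (z + INR (S n))).
rewrite fact_simpl, mult_INR, RtoC_mult.
replace (Cexp (z * ln (INR n))) with
  (Cexp (z * ln (INR (S n))) * Cexp (- (z * RtoC (ln (INR (S n)) - ln (INR n)))))
  by (rewrite <- Cexp_plus, RtoC_minus; f_equal; ring).
field; repeat split;
  first [ apply INR_neq_0 | apply Cexp_neq_0 | now apply rising_neq_0
        | apply Re_neq_0; rewrite re_RtoC; apply INR_fact_lt_0
        | now apply Re_neq_0, Re_plus_INR_pos ].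
Qed.

Lemma ln_succ_bounds (n : nat) :
  (/ INR (S (S n)) <= ln (INR (S (S n))) - ln (INR (S n)) <= / INR (S n))%R.
Proof.
assert (ln_le_sub_1 : forall t, (0 < t -> ln t <= t - 1)%R).
{ intros t Ht; pose proof (exp_ineq1_le (ln t)) as H; rewrite exp_ln in H by exact Ht; lra. }
pose proof (lt_0_INR (S n) ltac:(lia)) as H1.
pose proof (lt_0_INR (S (S n)) ltac:(lia)) as H2.
assert (E : INR (S (S n)) = (INR (S n) + 1)%R) by apply S_INR.
rewrite <- ln_div by assumption; split.
- pose proof (ln_le_sub_1 (INR (S n) / INR (S (S n)))%R ltac:(now apply Rdiv_lt_0_compat)) as H.
  rewrite ln_div in H |- * by assumption.
  replace (INR (S n) / INR (S (S n)) - 1)%R with (- / INR (S (S n)))%R in H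
    by (rewrite E; field; lra).
  lra.
- eapply Rle_trans; [ apply ln_le_sub_1; now apply Rdiv_lt_0_compat | ].
  rewrite E; right; field; lra.
Qed.

(** With [d = ln(n+2) - ln(n+1)] and [h = 1/(n+2)] the ratio is [e^(-zd) (1 + zh)].
    To first order it is [1 + z (h - d)], and [d - h] is itself of second order
    because [1/(n+2) <= d <= 1/(n+1)]. *)
Lemma Gamma_seq_inverse_ratio_bound (z : C) : (0 < Re z)%R -> exists K : R, forall n,
  (Cmod (Gamma_seq z (S n) / Gamma_seq z (S (S n)) - 1)
   <= K / (INR (S n) * INR (S (S n))))%R.
Proof.
intro Hz; set (r := Cmod z); pose proof (Cmod_ge_0 z) as Hr; fold r in Hr.
exists (r + 2 * r ^ 2 + 2 * ((3 + r) * exp r * r ^ 2) * (1 + r))%R; intro n.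
rewrite Gamma_seq_ratio by exact Hz.
pose proof (ln_succ_bounds n) as Hd.
set (d := (ln (INR (S (S n))) - ln (INR (S n)))%R) in *.
assert (HN : (1 <= INR (S n))%R) by (rewrite S_INR; pose proof (pos_INR n); lra).
assert (HM : INR (S (S n)) = (INR (S n) + 1)%R) by apply S_INR.
set (N := INR (S n)) in *; set (M := INR (S (S n))) in *.
assert (HNi : (0 < / N <= 1)%R).
{ split; [ apply Rinv_0_lt_compat; lra | ]; rewrite <- Rinv_1; apply Rinv_le_contravar; lra. }
assert (HMi : (0 < / M)%R) by (apply Rinv_0_lt_compat; lra).
assert (Hdiff : (/ N - / M = / N * / M)%R) by (rewrite HM; field; lra).
assert (HNM : (/ N <= 2 * / M)%R).
{ replace (/ N)%R with (/ N * / M + / M)%R by lra; nra. }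
set (E := Cexp (- (z * d)) - 1 - - (z * d)).
assert (Hzd : (Cmod (- (z * d)) = r * d)%R).
{ rewrite Cmod_opp, Cmod_mult, Cmod_R, Rabs_pos_eq by lra; reflexivity. }
assert (HE : (Cmod E <= (3 + r) * exp r * r ^ 2 * d ^ 2)%R).
{ replace ((3 + r) * exp r * r ^ 2 * d ^ 2)%R
    with ((3 + r) * exp r * Cmod (- (z * d)) ^ 2)%R by (rewrite Hzd; ring).
  apply Cmod_Cexp_sub_1_sub_le; rewrite Hzd; nra. }
replace (Cexp (- (z * d)) * (1 + z / M) - 1)
  with (z * RtoC (/ M - d) + - (z * z * RtoC (d * / M)) + E * (1 + z * RtoC (/ M))).
2:{ unfold E; rewrite RtoC_minus, RtoC_mult, RtoC_inv by lra; field.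
    intro H0; apply RtoC_inj in H0; lra. }
eapply Rle_trans; [ apply Cmod_triangle | ].
eapply Rle_trans; [ apply Rplus_le_compat_r, Cmod_triangle | ].
assert (T1 : (Cmod (z * RtoC (/ M - d)) <= r * (/ N * / M))%R).
{ rewrite Cmod_mult, Cmod_R, <- Hdiff; fold r; apply Rmult_le_compat_l; [ lra | ].
  apply Rabs_le_between; lra. }
assert (T2 : (Cmod (- (z * z * RtoC (d * / M))) <= r ^ 2 * (/ N * / M))%R).
{ rewrite Cmod_opp, !Cmod_mult, Cmod_R, Rabs_pos_eq by nra; fold r; simpl; rewrite Rmult_1_r.
  apply Rmult_le_compat_l; nra. }
assert (T3 : (Cmod (E * (1 + z * RtoC (/ M)))
   <= (3 + r) * exp r * r ^ 2 * (2 * (/ N * / M)) * (1 + r))%R).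
{ rewrite Cmod_mult; apply Rmult_le_compat; try apply Cmod_ge_0.
  - eapply Rle_trans; [ exact HE | ]; apply Rmult_le_compat_l.
    + pose proof (exp_pos r); pose proof (pow_le r 2 Hr).
      apply Rmult_le_pos; [ apply Rmult_le_pos; lra | lra ].
    + simpl; rewrite Rmult_1_r; nra.
  - eapply Rle_trans; [ apply Cmod_triangle | ].
    rewrite Cmod_1, Cmod_mult, Cmod_R, Rabs_pos_eq by lra; fold r; nra. }
assert (Hr2 : (0 <= r ^ 2 * (/ N * / M))%R) by (apply Rmult_le_pos; [ apply pow_le; lra | nra ]).
unfold Rdiv; rewrite Rinv_mult by lra; lra.
Qed.

(** The bound on the ratios passes to their inverses, since those have modulus at
    most [exp |z|] when [Re z > 0]. *)
Lemma is_Clim_seq_Gamma (z : C) : (0 < Re z)%R ->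
  Gamma z <> 0 /\ is_Clim_seq (Gamma_seq z) (Gamma z).
Proof.
intro Hz; destruct (Gamma_seq_inverse_ratio_bound z Hz) as [K HK].
assert (HK0 : (0 <= K)%R).
{ pose proof (Rle_trans _ _ _ (Cmod_ge_0 _) (HK 0%nat)) as H; simpl in H; lra. }
set (c := exp (Cmod z)).
assert (Hc : (1 <= c)%R) by (unfold c; pose proof (exp_ineq1_le (Cmod z)); pose proof (Cmod_ge_0 z); lra).
assert (Hpos : forall n, (0 < / (INR (S n) * INR (S (S n))))%R).
{ intro n; apply Rinv_0_lt_compat, Rmult_lt_0_compat; apply lt_0_INR; lia. }
destruct (ex_Clim_seq_product_nonzero (Gamma_seq z) (c * K)) as [l [Hl Hlim]].
- intro n; now apply Gamma_seq_neq_0.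
- intro n.
  set (p := Gamma_seq z (S n)); set (q := Gamma_seq z (S (S n))).
  assert (Hp : p <> 0) by now apply Gamma_seq_neq_0.
  assert (Hq : q <> 0) by now apply Gamma_seq_neq_0.
  replace (q / p - 1) with (- (/ (p / q) * (p / q - 1))) by (field; auto).
  rewrite Cmod_opp, Cmod_mult; unfold Rdiv; rewrite Rmult_assoc.
  apply Rmult_le_compat; try apply Cmod_ge_0; [ | apply HK ].
  unfold p, q; rewrite Gamma_seq_ratio by exact Hz.
  set (d := (ln (INR (S (S n))) - ln (INR (S n)))%R).
  assert (Hd : (0 <= d <= 1)%R).
  { pose proof (ln_succ_bounds n) as H; fold d in H.
    assert (0 < / INR (S (S n)))%R by (apply Rinv_0_lt_compat, lt_0_INR; lia).
    assert (/ INR (S n) <= 1)%R.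
    { rewrite <- Rinv_1; apply Rinv_le_contravar; [ lra | ].
      rewrite S_INR; pose proof (pos_INR n); lra. }
    lra. }
  assert (Hm : (1 <= Cmod (1 + z / INR (S (S n))))%R).
  { eapply Rle_trans; [ | apply re_le_Cmod ]; eapply Rle_trans; [ | apply Rle_abs ].
    unfold Cdiv; rewrite <- RtoC_inv by (apply not_0_INR; lia).
    rewrite re_plus, re_RtoC, re_scal_r.
    assert (0 < / INR (S (S n)))%R by (apply Rinv_0_lt_compat, lt_0_INR; lia); nra. }
  rewrite Cmod_inv, Cmod_mult, Rinv_mult, Cmod_Cexp.
  2:{ apply Cmult_neq_0; [ apply Cexp_neq_0 | apply Cmod_gt_0; lra ]. }
  rewrite <- (Rmult_1_r c); apply Rmult_le_compat.
  + left; apply Rinv_0_lt_compat, exp_pos.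
  + left; apply Rinv_0_lt_compat; lra.
  + rewrite <- exp_Ropp, re_opp, Ropp_involutive, re_scal_r; unfold c.
    assert (Re z * d <= Cmod z)%R.
    { pose proof (re_le_Cmod z); pose proof (Rle_abs (Re z)); nra. }
    destruct H as [H | H]; [ left; now apply exp_increasing | right; now rewrite H ].
  + apply Rle_trans with (/ 1)%R; [ apply Rinv_le_contravar; lra | rewrite Rinv_1; lra ].
- intro n; eapply Rle_trans; [ apply HK | ].
  unfold Rdiv; apply Rmult_le_compat_r; [ left; apply Hpos | nra ].
- assert (Gamma z = l) as -> by now apply Clim_seq_eq.
  now split.
Qed.

(** * Uniform convergence of the continued fraction in the right half-plane *)

(** Unlike [Kfrac], takes the tail [w] that closes the fraction as an argument: the
    value is the composition of the maps [v |-> a_j / (x + v)] at [w]. *)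
Fixpoint cf (a : nat -> R) (x : C) (k n : nat) (w : C) : C :=
  match n with
  | O => w
  | S n' => a k / (x + cf a x (S k) n' w)
  end.

Lemma cf_add (a : nat -> R) (x : C) (k m n : nat) (w : C) :
  cf a x k (m + n) w = cf a x k m (cf a x (k + m) n w).
Proof.
revert k; induction m as [ | m IH ]; intro k; simpl.
- now rewrite Nat.add_0_r.
- rewrite IH; now replace (S k + m)%nat with (k + S m)%nat by lia.
Qed.

Lemma Re_div_nonneg (r : R) (z : C) : (0 <= r)%R -> (0 < Re z)%R -> (0 <= Re (r / z))%R.
Proof.
intros Hr Hz; unfold Cdiv; rewrite re_scal_l; apply Rmult_le_pos; [ exact Hr | ].
destruct z as [p q]; unfold Re, Cinv in *; simpl in *.
apply Rdiv_le_0_compat; nra.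
Qed.

Lemma Re_cf_nonneg (a : nat -> R) (x : C) (k n : nat) (w : C) :
  (forall i, 0 <= a (S i))%R -> (0 < Re x)%R -> (0 <= Re w)%R ->
  (0 <= Re (cf a x (S k) n w))%R.
Proof.
intros Ha Hx Hw; revert k; induction n as [ | n IH ]; intro k; cbn [cf]; [ exact Hw | ].
apply Re_div_nonneg; [ apply Ha | rewrite re_plus; specialize (IH (S k)); lra ].
Qed.

(** The denominators [B_n] of the approximants. *)
Fixpoint cf_den (a : nat -> R) (x : C) (n : nat) : C :=
  match n with
  | O => 1
  | S O => x
  | S (S k as m) => x * cf_den a x m + a n * cf_den a x k
  end.

Fixpoint cf_prod (a : nat -> R) (n : nat) : R :=
  match n with O => 1 | S m => cf_prod a m * a n end.

(** The right half-plane is mapped by the first [n + 1] steps of the fraction onto a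
    disc of diameter [1 / cf_gap a x n]. *)
Definition cf_gap (a : nat -> R) (x : C) (n : nat) : R :=
  (Re (cf_den a x (S n) * Cconj (cf_den a x n)) / cf_prod a (S n))%R.

(** The increments of [cf_gap], up to the factor [Re x]. *)
Definition cf_weight (a : nat -> R) (x : C) (n : nat) : R :=
  (Cmod (cf_den a x n) ^ 2 / cf_prod a (S n))%R.

Lemma cf_prod_pos (a : nat -> R) (n : nat) :
  (forall i, 0 < a (S i))%R -> (0 < cf_prod a n)%R.
Proof.
intro Ha; induction n as [ | n IH ]; simpl; [ lra | now apply Rmult_lt_0_compat ].
Qed.

Lemma Re_mul_conj_l (z w : C) : Re (z * w * Cconj w) = (Re z * Cmod w ^ 2)%R.
Proof. rewrite Cmod2_alt; destruct z, w; unfold Re, Im, Cconj; simpl; ring. Qed.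

Lemma cf_gap_0 (a : nat -> R) (x : C) : cf_gap a x 0 = (Re x / a 1%nat)%R.
Proof. unfold cf_gap; simpl; destruct x; simpl; f_equal; ring. Qed.

Lemma cf_gap_succ (a : nat -> R) (x : C) (n : nat) : (forall i, 0 < a (S i))%R ->
  cf_gap a x (S n) = (cf_gap a x n + Re x * cf_weight a x (S n))%R.
Proof.
intro Ha; unfold cf_gap, cf_weight.
change (cf_den a x (S (S n))) with (x * cf_den a x (S n) + a (S (S n)) * cf_den a x n).
change (cf_prod a (S (S n))) with (cf_prod a (S n) * a (S (S n)))%R.
pose proof (cf_prod_pos a (S n) Ha); pose proof (Ha (S n)).
set (z := cf_den a x (S n)); set (w := cf_den a x n).
replace (Re ((x * z + a (S (S n)) * w) * Cconj z))
  with (Re x * Cmod z ^ 2 + a (S (S n)) * Re (z * Cconj w))%R.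
- field; lra.
- rewrite <- Re_mul_conj_l; destruct x, z, w; unfold Re, Cconj; simpl; ring.
Qed.

Lemma cf_gap_pos (a : nat -> R) (x : C) (n : nat) :
  (forall i, 0 < a (S i))%R -> (0 < Re x)%R ->
  (Re x / a 1%nat <= cf_gap a x n)%R /\ (0 < cf_gap a x n)%R.
Proof.
intros Ha Hx.
assert (H0 : (0 < Re x / a 1%nat)%R) by (apply Rdiv_lt_0_compat; [ exact Hx | apply Ha ]).
induction n as [ | n IH ]; [ rewrite cf_gap_0; lra | ].
rewrite cf_gap_succ by exact Ha.
assert (0 <= cf_weight a x (S n))%R.
{ apply Rdiv_le_0_compat; [ apply pow2_ge_0 | now apply cf_prod_pos ]. }
nra.
Qed.

(** The composition of the first [n + 1] steps is the Moebius map
    [w |-> (A_(n+1) + A_n w) / (B_(n+1) + B_n w)], whose determinant is the product of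
    the [a_i] up to sign; the numerators [A] cancel in the difference. *)
Lemma cf_diff (a : nat -> R) (x : C) (n : nat) (w w' : C) :
  (forall i, 0 < a (S i))%R -> (0 < Re x)%R -> (0 <= Re w)%R -> (0 <= Re w')%R ->
  (Cmod (cf a x 1 (S n) w - cf a x 1 (S n) w') *
    (Cmod (cf_den a x (S n) + cf_den a x n * w) * Cmod (cf_den a x (S n) + cf_den a x n * w'))
  = cf_prod a (S n) * Cmod (w - w'))%R.
Proof.
intros Ha Hx; revert w w'; induction n as [ | n IH ]; intros w w' Hw Hw'.
- simpl.
  assert (x + w <> 0) by (apply Re_neq_0; rewrite re_plus; lra).
  assert (x + w' <> 0) by (apply Re_neq_0; rewrite re_plus; lra).
  replace (a 1%nat / (x + w) - a 1%nat / (x + w'))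
    with (- (a 1%nat * (w - w') / ((x + w) * (x + w')))) by (field; auto).
  rewrite Cmod_opp, Cmod_div, !Cmod_mult, Cmod_R, Rabs_pos_eq by
    (try apply Cmult_neq_0; auto; left; apply Ha).
  rewrite !Cmult_1_l; field; split; apply Rgt_not_eq, Cmod_gt_0; auto.
- replace (S (S n)) with (S n + 1)%nat at 1 2 by lia.
  rewrite !cf_add; simpl (cf a x (1 + S n) 1 _).
  assert (Hn : x + w <> 0) by (apply Re_neq_0; rewrite re_plus; lra).
  assert (Hn' : x + w' <> 0) by (apply Re_neq_0; rewrite re_plus; lra).
  assert (Hr : forall v, (0 <= Re v)%R -> (0 <= Re (a (S (S n)) / (x + v)))%R).
  { intros v Hv; apply Re_div_nonneg; [ left; apply Ha | rewrite re_plus; lra ]. }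
  specialize (IH _ _ (Hr w Hw) (Hr w' Hw')).
  change (cf_den a x (S (S n))) with (x * cf_den a x (S n) + a (S (S n)) * cf_den a x n).
  change (cf_prod a (S (S n))) with (cf_prod a (S n) * a (S (S n)))%R.
  set (z := cf_den a x (S n)) in *; set (y := cf_den a x n) in *.
  assert (Hden : forall v, x + v <> 0 ->
    x * z + a (S (S n)) * y + z * v = (x + v) * (z + y * (a (S (S n)) / (x + v)))).
  { intros v Hv; field; exact Hv. }
  rewrite !Hden, !Cmod_mult by assumption.
  replace (a (S (S n)) / (x + w) - a (S (S n)) / (x + w'))
    with (- (a (S (S n)) * (w - w') / ((x + w) * (x + w')))) in IH by (field; auto).
  rewrite Cmod_opp, Cmod_div, !Cmod_mult, Cmod_R, Rabs_pos_eq in IH by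
    (try apply Cmult_neq_0; auto; left; apply Ha).
  apply Cmod_gt_0 in Hn; apply Cmod_gt_0 in Hn'.
  match goal with |- (?d * (?p * ?q * (?r * ?s)) = _)%R =>
    transitivity (d * (q * s) * (p * r))%R; [ ring | rewrite IH ] end.
  field; lra.
Qed.

(** Both points are within [1 / cf_gap a x n], the diameter of the disc, of the image of
    the point at infinity; whence the factor 2. *)
Lemma cf_diff_le (a : nat -> R) (x : C) (n : nat) (w w' : C) :
  (forall i, 0 < a (S i))%R -> (0 < Re x)%R -> (0 <= Re w)%R -> (0 <= Re w')%R ->
  (Cmod (cf a x 1 (S n) w - cf a x 1 (S n) w') <= 2 / cf_gap a x n)%R.
Proof.
intros Ha Hx Hw Hw'; pose proof (cf_diff a x n w w' Ha Hx Hw Hw') as H.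
pose proof (cf_gap_pos a x n Ha Hx) as [_ HD].
pose proof (cf_prod_pos a (S n) Ha) as HP.
set (d := Cmod (_ - cf _ _ _ _ _)) in *.
assert (Hd : (0 <= d)%R) by apply Cmod_ge_0.
set (z := cf_den a x (S n)) in *; set (y := cf_den a x n) in *.
set (D := cf_gap a x n) in *; set (P := cf_prod a (S n)) in *.
(* Multiply the denominator by the conjugate of B_n and take real parts. *)
assert (Hlow : forall v, (0 <= Re v)%R -> (P * D <= Cmod y * Cmod (z + y * v))%R).
{ intros v Hv; unfold D, cf_gap; fold z y P.
  rewrite <- (Cmod_conj y), <- Cmod_mult.
  eapply Rle_trans; [ | apply re_le_Cmod ]; eapply Rle_trans; [ | apply Rle_abs ].
  replace (Cconj y * (z + y * v)) with (z * Cconj y + v * y * Cconj y) by ring.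
  rewrite re_plus, Re_mul_conj_l.
  assert (0 <= Re v * Cmod y ^ 2)%R by (apply Rmult_le_pos; [ exact Hv | apply pow2_ge_0 ]).
  replace (P * (Re (z * Cconj y) / P))%R with (Re (z * Cconj y)) by (field; lra).
  lra. }
pose proof (Hlow w Hw) as H1; pose proof (Hlow w' Hw') as H2.
assert (HPD : (0 < P * D)%R) by now apply Rmult_lt_0_compat.
assert (Hy : (0 < Cmod y)%R).
{ destruct (Cmod_ge_0 y) as [ | E ]; [ assumption | rewrite <- E in H1; lra ]. }
assert (Hww : (Cmod y * Cmod (w - w') <= Cmod (z + y * w) + Cmod (z + y * w'))%R).
{ rewrite <- Cmod_mult.
  replace (y * (w - w')) with ((z + y * w) + - (z + y * w')) by ring.
  eapply Rle_trans; [ apply Cmod_triangle | ]; rewrite Cmod_opp; lra. }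
set (p := Cmod (z + y * w)) in *; set (q := Cmod (z + y * w')) in *.
assert (Hp : (0 < p)%R) by nra.
assert (Hq : (0 < q)%R) by nra.
assert (Hm : (d * (Cmod y * p) * (Cmod y * q) <= P * (Cmod y * p + Cmod y * q))%R).
{ replace (d * (Cmod y * p) * (Cmod y * q))%R with (d * (p * q) * Cmod y * Cmod y)%R by ring.
  rewrite H.
  replace (P * Cmod (w - w') * Cmod y * Cmod y)%R
    with (P * (Cmod y * (Cmod y * Cmod (w - w'))))%R by ring.
  apply Rmult_le_compat_l; [ lra | ]; rewrite <- Rmult_plus_distr_l.
  apply Rmult_le_compat_l; lra. }
set (s := (Cmod y * p)%R) in *; set (t := (Cmod y * q)%R) in *.
assert (Hs : (0 < s)%R) by lra. assert (Ht : (0 < t)%R) by lra.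
apply Rle_trans with (P * (s + t) / (s * t))%R.
- apply Rmult_le_reg_r with (s * t)%R; [ nra | ].
  replace (P * (s + t) / (s * t) * (s * t))%R with (P * (s + t))%R by (field; lra). lra.
- replace (P * (s + t) / (s * t))%R with (P * / s + P * / t)%R by (field; lra).
  assert (Hi : forall r, (P * D <= r -> P * / r <= / D)%R).
  { intros r Hr; replace (/ D)%R with (P * / (P * D))%R by (field; lra).
    apply Rmult_le_compat_l; [ lra | now apply Rinv_le_contravar ]. }
  pose proof (Hi s H1); pose proof (Hi t H2); unfold Rdiv; lra.
Qed.

(** The product of the two weights is at least [(cf_gap a x n)^2 / a_(n+2)], because
    [|B_(n+1)| |B_n| >= Re (B_(n+1) conj B_n)]; by the inequality between the
    arithmetic and geometric means this bounds their sum below. *)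
Lemma cf_weight_pair_ge (a : nat -> R) (x : C) (n : nat) :
  (forall i, 0 < a (S i) <= INR (S i) ^ 2)%R -> (0 < Re x)%R ->
  (Re x / a 1%nat * / INR (S (S n)) <= cf_weight a x n + cf_weight a x (S n))%R.
Proof.
intros Ha' Hx; assert (Ha : forall i, (0 < a (S i))%R) by (intro; apply Ha').
pose proof (cf_gap_pos a x n Ha Hx) as [Hc _].
assert (H0 : (0 < Re x / a 1%nat)%R) by (apply Rdiv_lt_0_compat; [ exact Hx | apply Ha ]).
set (c := (Re x / a 1%nat)%R) in *.
pose proof (cf_prod_pos a (S n) Ha) as HP; pose proof (Ha' (S n)) as Han.
assert (Hb : forall i, (0 <= cf_weight a x i)%R).
{ intro i; apply Rdiv_le_0_compat; [ apply pow2_ge_0 | now apply cf_prod_pos ]. }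
pose proof (Hb n) as Hb1; pose proof (Hb (S n)) as Hb2.
assert (HN : (0 < INR (S (S n)))%R) by (apply lt_0_INR; lia).
assert (Hprod : ((c * / INR (S (S n))) ^ 2 <= cf_weight a x n * cf_weight a x (S n))%R).
{ unfold cf_gap in Hc; unfold cf_weight.
  change (cf_prod a (S (S n))) with (cf_prod a (S n) * a (S (S n)))%R.
  set (z := cf_den a x (S n)) in *; set (y := cf_den a x n) in *.
  set (P := cf_prod a (S n)) in *; set (N := INR (S (S n))) in *; set (q := a (S (S n))) in *.
  assert (Hm : (c * P <= Cmod z * Cmod y)%R).
  { rewrite <- (Cmod_conj y), <- Cmod_mult.
    eapply Rle_trans; [ | apply re_le_Cmod ]; eapply Rle_trans; [ | apply Rle_abs ].
    apply Rmult_le_compat_r with (r := P) in Hc; [ | lra ].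
    replace (Re (z * Cconj y) / P * P)%R with (Re (z * Cconj y)) in Hc by (field; lra).
    exact Hc. }
  assert (Hm2 : ((c * P) ^ 2 <= (Cmod z * Cmod y) ^ 2)%R) by (apply pow_incr; nra).
  replace (Cmod y ^ 2 / P * (Cmod z ^ 2 / (P * q)))%R
    with ((Cmod z * Cmod y) ^ 2 * / (P ^ 2 * q))%R by (field; lra).
  apply Rle_trans with ((c * P) ^ 2 * / (P ^ 2 * q))%R.
  - replace ((c * P) ^ 2 * / (P ^ 2 * q))%R with (c ^ 2 * / q)%R by (field; lra).
    replace ((c * / N) ^ 2)%R with (c ^ 2 * / N ^ 2)%R by (field; lra).
    apply Rmult_le_compat_l; [ apply pow2_ge_0 | ].
    apply Rinv_le_contravar; lra.
  - apply Rmult_le_compat_r; [ | exact Hm2 ].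
    left; apply Rinv_0_lt_compat, Rmult_lt_0_compat; [ now apply pow_lt | lra ]. }
apply Rnot_lt_le; intro Hlt.
assert (0 < / INR (S (S n)))%R by now apply Rinv_0_lt_compat.
nra.
Qed.

(** Two consecutive increments add up to at least a constant over [n], so the gaps
    grow like a logarithm. *)
Lemma is_lim_seq_cf_gap (a : nat -> R) (x : C) :
  (forall i, 0 < a (S i) <= INR (S i) ^ 2)%R -> (0 < Re x)%R ->
  is_lim_seq (cf_gap a x) p_infty.
Proof.
intros Ha' Hx; assert (Ha : forall i, (0 < a (S i))%R) by (intro; apply Ha').
assert (H0 : (0 < Re x / a 1%nat)%R) by (apply Rdiv_lt_0_compat; [ exact Hx | apply Ha ]).
set (K := (Re x * (Re x / a 1%nat))%R).
assert (HK : (0 < K)%R) by now apply Rmult_lt_0_compat.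
(* The weights are bounded below in pairs only, so consecutive gaps are added. *)
assert (HE : forall n, (K * (ln (INR (S (S (S n)))) - ln 3)
    <= cf_gap a x n + cf_gap a x (S n))%R).
{ induction n as [ | n IH ].
  - replace (INR 3) with 3%R by (simpl; ring).
    pose proof (cf_gap_pos a x 0 Ha Hx); pose proof (cf_gap_pos a x 1 Ha Hx); lra.
  - pose proof (cf_gap_succ a x (S n) Ha) as H1; pose proof (cf_gap_succ a x n Ha) as H2.
    pose proof (cf_weight_pair_ge a x (S n) Ha' Hx) as H3.
    pose proof (ln_succ_bounds (S (S n))) as [_ H4].
    apply Rmult_le_compat_l with (r := Re x) in H3; [ | lra ].
    apply Rmult_le_compat_l with (r := K) in H4; [ | lra ].
    rewrite <- Rmult_assoc in H3; fold K in H3; lra. }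
apply is_lim_seq_incr_1.
apply is_lim_seq_le_p_loc with (fun n => K / 2 * (ln (INR (n + 3)) - ln 3))%R.
- exists 0%nat; intros n _; specialize (HE n).
  replace (n + 3)%nat with (S (S (S n))) by lia.
  pose proof (cf_gap_succ a x n Ha) as H1.
  assert (0 <= cf_weight a x (S n))%R.
  { apply Rdiv_le_0_compat; [ apply pow2_ge_0 | now apply cf_prod_pos ]. }
  nra.
- assert (Hln : is_lim_seq (fun n => ln (INR (n + 3))) p_infty).
  { apply (is_lim_seq_incr_n (fun n => ln (INR n)) 3).
    eapply filterlim_comp; [ apply is_lim_seq_INR | apply is_lim_ln_p ]. }
  eapply is_lim_seq_mult; [ apply is_lim_seq_const | | ].
  + eapply is_lim_seq_minus; [ exact Hln | apply is_lim_seq_const | reflexivity ].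
  + simpl; unfold is_Rbar_mult, Rbar_mult'.
    destruct (Rle_dec 0 (K / 2)) as [H | H]; [ | lra ].
    destruct (Rle_lt_or_eq_dec 0 (K / 2) H); [ reflexivity | lra ].
Qed.

(** Longer approximants are shorter ones with another tail in the half-plane, so the
    bound of [cf_diff_le] gives a Cauchy sequence and also compares all choices of
    tails, unbounded ones included. *)
Lemma cf_uniform_limit (a : nat -> R) (x : C) :
  (forall i, 0 < a (S i) <= INR (S i) ^ 2)%R -> (0 < Re x)%R ->
  exists t : C, forall w : nat -> C,
    eventually (fun n => 0 <= Re (w n))%R -> is_Clim_seq (fun n => cf a x 1 n (w n)) t.
Proof.
intros Ha' Hx; assert (Ha : forall i, (0 < a (S i))%R) by (intro; apply Ha').
assert (Ha0 : forall i, (0 <= a (S i))%R) by (intro; left; apply Ha').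
assert (He : is_lim_seq (fun n => 2 / cf_gap a x n)%R 0).
{ replace (Finite 0) with (Rbar_mult 2 (Rbar_inv p_infty)) by (simpl; f_equal; ring).
  apply is_lim_seq_scal_l, is_lim_seq_inv; [ now apply is_lim_seq_cf_gap | discriminate ]. }
destruct (ex_Clim_seq_Cauchy (fun n => cf a x 1 (S n) 0) (fun n => 2 / cf_gap a x n)%R)
  as [t [_ Ht]]; [ exact He | | ].
{ intros n k; rewrite <- Nat.add_succ_l, cf_add.
  apply cf_diff_le; auto; [ | simpl; lra ].
  apply (Re_cf_nonneg a x (S n) k 0); auto; simpl; lra. }
exists t; intros w Hw.
apply is_Clim_seq_le with (fun n => 2 / cf_gap a x (pred n) + 2 / cf_gap a x (pred n))%R.
- replace (Finite 0) with (Finite (0 + 0)) by (f_equal; ring).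
  apply is_lim_seq_plus'; apply (is_lim_seq_incr_1 (fun n => 2 / cf_gap a x (pred n))%R); exact He.
- destruct Hw as [N HN]; exists (S N); intros [ | n] Hn; [ lia | ]; simpl pred.
  replace (cf a x 1 (S n) (w (S n)) - t)
    with ((cf a x 1 (S n) (w (S n)) - cf a x 1 (S n) 0) + - (t - cf a x 1 (S n) 0)) by ring.
  eapply Rle_trans; [ apply Cmod_triangle | ].
  rewrite Cmod_opp; apply Rplus_le_compat; [ | apply Ht ].
  apply cf_diff_le; auto; [ apply HN; lia | simpl; lra ].
Qed.

(** * The coefficients *)

Lemma kappa_even_index (n : nat) : (1 <= n)%nat -> Nat.even n = true ->
  kappa n = ((3 * INR n - 2) ^ 3 / (108 * (INR n - 1)))%R.
Proof.
intros Hn He; apply Nat.even_spec in He; destruct He as [m ->].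
assert (Hm : (1 <= INR m)%R) by (apply (le_INR 1); lia).
rewrite kappa_even, mult_INR by lia; simpl (INR 2); field; lra.
Qed.

Lemma kappa_odd_index (n : nat) : Nat.even n = false ->
  kappa n = ((3 * INR n - 1) ^ 3 / (108 * INR n))%R.
Proof.
intros He; rewrite <- Nat.negb_odd in He; apply Bool.negb_false_iff, Nat.odd_spec in He.
destruct He as [m ->].
pose proof (pos_INR m).
replace (2 * m + 1)%nat with (2 * S m - 1)%nat at 1 by lia.
rewrite kappa_odd, plus_INR, mult_INR, S_INR by lia; simpl (INR 2); simpl (INR 1).
field; lra.
Qed.

Lemma kappa_bounds (i : nat) : (0 < kappa (S i) <= INR (S i) ^ 2)%R.
Proof.
destruct (Nat.even (S i)) eqn:He.
- rewrite kappa_even_index by (assumption || lia).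
  assert (Hn : (2 <= INR (S i))%R).
  { apply (le_INR 2); destruct i; [ discriminate | lia ]. }
  set (N := INR (S i)) in *; split.
  + apply Rdiv_lt_0_compat; [ apply pow_lt; lra | lra ].
  + apply Rle_div_l; [ lra | ].
    assert (0 <= (N - 2) * (81 * N ^ 2))%R by (apply Rmult_le_pos; nra).
    simpl in *; nra.
- rewrite kappa_odd_index by assumption.
  assert (Hn : (1 <= INR (S i))%R) by (apply (le_INR 1); lia).
  set (N := INR (S i)) in *; split.
  + apply Rdiv_lt_0_compat; [ apply pow_lt; lra | lra ].
  + apply Rle_div_l; [ lra | ]; simpl; nra.
Qed.

(** * The Moebius map between the fractions at x and x + 2 *)

(** The coefficients with even and odd indices follow different formulas; in the
    matrices below this leaves a trace, apart from [kappa] itself, only in the constant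
    terms on the diagonal. *)
Definition shift_parity (n : nat) : R := if Nat.even n then 8 else 10.

Lemma shift_parity_succ (n : nat) : shift_parity (S n) = (18 - shift_parity n)%R.
Proof.
unfold shift_parity; rewrite Nat.even_succ, <- Nat.negb_even.
destruct (Nat.even n); simpl; ring.
Qed.

(** The sole property of the coefficients on which the commutation of the matrices
    rests. *)
Lemma kappa_diff (n : nat) : (1 <= n)%nat ->
  (54 * ((INR n + 1) * kappa (S n) - (INR n - 1) * kappa n)
   = 54 * INR n ^ 2 + shift_parity n)%R.
Proof.
intro Hn; unfold shift_parity.
assert (HN : (1 <= INR n)%R) by (apply (le_INR 1); lia).
destruct (Nat.even n) eqn:He.
- rewrite (kappa_even_index n), (kappa_odd_index (S n)), S_INR
    by (assumption || (rewrite Nat.even_succ, <- Nat.negb_even, He; reflexivity)).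
  assert (HN2 : (2 <= INR n)%R).
  { apply (le_INR 2); destruct n as [ | [ | n ] ]; [ lia | discriminate | lia ]. }
  field; lra.
- rewrite (kappa_odd_index n), (kappa_even_index (S n)), S_INR
    by (assumption || lia || (rewrite Nat.even_succ, <- Nat.negb_even, He; reflexivity)).
  field; lra.
Qed.

Definition shift_d (n : nat) (x : C) : C :=
  27 * x ^ 3 + 54 * (INR n + 1) * x ^ 2 + (54 * INR n ^ 2 + 54 * INR n + 36) * x
  + 54 * INR n ^ 2 + shift_parity n.

(** The term [18 - shift_parity n] is the parity constant of the index [n - 1], written
    without a truncated predecessor. *)
Definition shift_e (n : nat) (x : C) : C :=
  27 * x ^ 3 - 54 * (INR n - 2) * x ^ 2
  + (54 * (INR n - 2) ^ 2 + 54 * (INR n - 2) + 36) * x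
  + 54 * (INR n - 1) ^ 2 + (18 - shift_parity n).

(** The Moebius map with matrix
    [N_n = (d_n, -108 n kappa_n (x+1); -108 (n-1) (x+1), e_n)] sends [u] to [v].  The
    matrices are found by solving [N_n T_n(x) = T_n(x+2) N_(n+1)] recursively from an
    upper triangular [N_1] that expresses the functional equation.  The denominator is
    cleared so that no case of a vanishing denominator arises. *)
Definition shift_rel (n : nat) (x u v : C) : Prop :=
  shift_d n x * u - 108 * INR n * kappa n * (x + 1)
  = v * (shift_e n x - 108 * (INR n - 1) * (x + 1) * u).

Lemma shift_e_succ (n : nat) (x : C) :
  shift_e (S n) x = shift_d n x - 108 * INR n * (x + 1) * x.
Proof.
unfold shift_e, shift_d; rewrite shift_parity_succ, S_INR, RtoC_plus, RtoC_minus; ring.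
Qed.

Lemma shift_d_succ (n : nat) (x : C) :
  shift_d (S n) x = shift_e n x + 108 * INR n * (x + 1) * (x + 2).
Proof.
unfold shift_e, shift_d; rewrite shift_parity_succ, S_INR, RtoC_plus, RtoC_minus; ring.
Qed.

Lemma shift_kappa (n : nat) (x : C) : (1 <= n)%nat ->
  108 * (x + 1) * ((INR n + 1) * kappa (S n) - (INR n - 1) * kappa n)
  = (x + 2) * shift_e (S n) x - x * shift_e n x.
Proof.
intro Hn; pose proof (f_equal RtoC (kappa_diff n Hn)) as H.
rewrite RtoC_mult, RtoC_minus, !RtoC_mult, !RtoC_plus, RtoC_minus, RtoC_mult, RtoC_pow in H.
transitivity (2 * (x + 1) * (54 * INR n ^ 2 + shift_parity n)).
- rewrite <- H; ring.
- rewrite shift_e_succ; unfold shift_e, shift_d; ring.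
Qed.

(** The identity [N_n T_n(x) = T_n(x+2) N_(n+1)]: its four entries are [shift_e_succ],
    [shift_d_succ], [shift_kappa] and a trivial one. *)
Lemma shift_rel_step (n : nat) (x u v : C) : (1 <= n)%nat ->
  x + u <> 0 -> x + 2 + v <> 0 ->
  shift_rel (S n) x u v -> shift_rel n x (kappa n / (x + u)) (kappa n / (x + 2 + v)).
Proof.
unfold shift_rel; intros Hn Hu Hv H.
pose proof (shift_kappa n x Hn) as HK; pose proof (shift_e_succ n x) as He.
rewrite (S_INR n), RtoC_plus in H.
rewrite shift_d_succ in H.
set (N := RtoC (INR n)) in *; set (k := RtoC (kappa n)) in *; set (k' := RtoC (kappa (S n))) in *.
set (Q := shift_e (S n) x - 108 * N * (x + 1) * u).
assert (H1 : shift_d n x * k - 108 * N * k * (x + 1) * (x + u) = k * Q).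
{ unfold Q; rewrite He; ring. }
assert (H2 : shift_e n x * (x + u) - 108 * (N - 1) * (x + 1) * k = (x + 2 + v) * Q).
{ transitivity ((shift_e n x + 108 * N * (x + 1) * (x + 2)) * u
    - 108 * (N + 1) * k' * (x + 1) + (108 * (x + 1) * ((N + 1) * k' - (N - 1) * k))
    + x * shift_e n x - 108 * N * (x + 1) * (x + 2) * u); [ ring | ].
  rewrite H, HK; unfold Q; ring. }
transitivity (k * Q / (x + u)).
- rewrite <- H1; field; exact Hu.
- transitivity (k / (x + 2 + v) * ((x + 2 + v) * Q / (x + u))); [ field; auto | ].
  rewrite <- H2; field; auto.
Qed.

Lemma shift_rel_cf (n k : nat) (x w v : C) : (0 < Re x)%R ->
  (0 <= Re w)%R -> (0 <= Re v)%R -> shift_rel (S k + n) x w v ->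
  shift_rel (S k) x (cf kappa x (S k) n w) (cf kappa (x + 2) (S k) n v).
Proof.
intros Hx Hw Hv; revert k; induction n as [ | n IH ]; intros k H.
- now rewrite Nat.add_0_r in H.
- replace (S k + S n)%nat with (S (S k) + n)%nat in H by lia.
  cbn [cf]; apply shift_rel_step; [ lia | | | now apply IH ].
  + apply Re_neq_0; rewrite re_plus.
    pose proof (Re_cf_nonneg kappa x (S k) n w ltac:(intro; left; apply kappa_bounds) Hx Hw); lra.
  + assert (Hx2 : (0 < Re (x + 2))%R) by (rewrite re_plus, re_RtoC; lra).
    pose proof (Re_cf_nonneg kappa (x + 2) (S k) n v ltac:(intro; left; apply kappa_bounds) Hx2 Hv).
    apply Re_neq_0; rewrite re_plus; lra.
Qed.

(** The point [108 n kappa_n (x+1) / d_n] that [N_n] sends to 0; dividing [d_n] by [x + 1]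
    makes the sign of its real part visible. *)
Definition shift_zero (n : nat) (x : C) : C :=
  RtoC (108 * INR n * kappa n)
  / (27 * x ^ 2 + (54 * INR n + 27) * x + 54 * INR n ^ 2 + 9 + (shift_parity n - 9) / (x + 1)).

(** The only negative contribution that is not bounded is [-27 (Im x)^2], and [54 n^2]
    outweighs it. *)
Lemma shift_zero_denom_pos (x : C) : (0 < Re x)%R ->
  eventually (fun n => 0 < Re (27 * x ^ 2 + (54 * INR n + 27) * x + 54 * INR n ^ 2 + 9
                                + (shift_parity n - 9) / (x + 1)))%R.
Proof.
intro Hx.
destruct (INR_unbounded (Rabs (Im x))) as [N HN].
exists N; intros n Hn.
assert (Hi : (Rabs (Im x) <= INR n)%R) by (apply le_INR in Hn; lra).
assert (Hsq : (Im x ^ 2 <= INR n ^ 2)%R).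
{ rewrite <- pow2_abs; apply pow_incr; split; [ apply Rabs_pos | exact Hi ]. }
assert (Hx1 : (1 < Cmod (x + 1))%R).
{ eapply Rlt_le_trans; [ | apply re_le_Cmod ]; eapply Rlt_le_trans; [ | apply Rle_abs ].
  rewrite re_plus, re_RtoC; lra. }
assert (Hq : (Rabs (Re ((shift_parity n - 9) / (x + 1))) <= 1)%R).
{ eapply Rle_trans; [ apply re_le_Cmod | ].
  rewrite Cmod_div by (apply Cmod_gt_0; lra).
  rewrite <- RtoC_minus, Cmod_R.
  replace (Rabs (shift_parity n - 9)) with 1%R.
  - apply Rle_div_l; lra.
  - unfold shift_parity; destruct (Nat.even n).
    + rewrite Rabs_left; lra.
    + rewrite Rabs_pos_eq; lra. }
apply Rabs_le_between in Hq.
rewrite re_plus.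
replace (Re (27 * x ^ 2 + (54 * INR n + 27) * x + 54 * INR n ^ 2 + 9))
  with (27 * (Re x ^ 2 - Im x ^ 2) + (54 * INR n + 27) * Re x + 54 * INR n ^ 2 + 9)%R.
- pose proof (pos_INR n); nra.
- destruct x as [p q]; unfold Re, Im; simpl; ring.
Qed.

Lemma shift_rel_zero (n : nat) (x : C) : (0 < Re x)%R ->
  (0 < Re (27 * x ^ 2 + (54 * INR n + 27) * x + 54 * INR n ^ 2 + 9
           + (shift_parity n - 9) / (x + 1)))%R ->
  shift_rel n x (shift_zero n x) 0.
Proof.
intros Hx Hd; unfold shift_rel, shift_zero.
set (q := 27 * x ^ 2 + _ + _ + _ + _) in *.
assert (Hx1 : x + 1 <> 0) by (apply Re_neq_0; rewrite re_plus, re_RtoC; lra).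
replace (shift_d n x) with ((x + 1) * q) by (unfold q, shift_d; field; exact Hx1).
rewrite !RtoC_mult; field; now apply Re_neq_0.
Qed.

(** [N_1] is upper triangular with diagonal [(3x+4)^3], [(3x+2)^3], so in the limit the
    relation [N_1 t = t'] is affine. *)
Lemma kappa_cf_shift (x t t' : C) : (0 < Re x)%R ->
  is_Clim_seq (fun n => cf kappa x 1 n 0) t ->
  is_Clim_seq (fun n => cf kappa (x + 2) 1 n 0) t' ->
  (3 * x + 2) ^ 3 * ((x + 2) / 2 + t') = (3 * x + 4) ^ 3 * (x / 2 + t).
Proof.
intros Hx Ht Ht'.
destruct (cf_uniform_limit kappa x kappa_bounds Hx) as [s Hs].
assert (t = s) as ->.
{ apply is_Clim_seq_unique with (1 := Ht), Hs; exists 0%nat; intros; simpl; lra. }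
assert (Hd : eventually (fun n => 0 < Re (27 * x ^ 2 + (54 * INR (S n) + 27) * x
         + 54 * INR (S n) ^ 2 + 9 + (shift_parity (S n) - 9) / (x + 1)))%R).
{ destruct (shift_zero_denom_pos x Hx) as [N HN]; exists N; intros n Hn; apply HN; lia. }
assert (Hw : eventually (fun n => 0 <= Re (shift_zero (S n) x))%R).
{ apply filter_imp with (2 := Hd); intros n Hn; apply Re_div_nonneg; [ | exact Hn ].
  pose proof (kappa_bounds n); pose proof (pos_INR (S n)); nra. }
specialize (Hs (fun n => shift_zero (S n) x) Hw).
assert (Hrel : shift_d 1 x * s - 8 * (x + 1) = t' * (3 * x + 2) ^ 3).
{ apply is_Clim_seq_unique with
    (fun n => cf kappa (x + 2) 1 n 0 * (3 * x + 2) ^ 3).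
  2: now apply is_Clim_seq_mult; [ | apply is_Clim_seq_const ].
  apply is_Clim_seq_ext_loc with
    (fun n => shift_d 1 x * cf kappa x 1 n (shift_zero (S n) x) + - (8 * (x + 1))).
  2: now apply is_Clim_seq_plus; [ apply is_Clim_seq_mult | ]; try apply is_Clim_seq_const.
  apply filter_imp with (2 := filter_and _ _ Hd Hw); intros n [Hn1 Hn2].
  pose proof (shift_rel_cf n 0 x (shift_zero (S n) x) 0 Hx Hn2 ltac:(simpl; lra)
    (shift_rel_zero (S n) x Hx Hn1)) as H.
  unfold shift_rel in H.
  replace (shift_e 1 x) with ((3 * x + 2) ^ 3) in H
    by (unfold shift_e, shift_parity; simpl; ring).
  replace (108 * INR 1 * kappa 1 * (x + 1)) with (8 * (x + 1)) in H.
  - transitivity (shift_d 1 x * cf kappa x 1 n (shift_zero (S n) x) - 8 * (x + 1)); [ ring | ].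
    rewrite H; simpl INR; ring.
  - replace (kappa 1) with (8 / 108)%R by (unfold kappa; simpl; field).
    rewrite RtoC_div by lra; simpl INR; field. }
replace (shift_d 1 x) with ((3 * x + 4) ^ 3) in Hrel
  by (unfold shift_d, shift_parity; simpl; ring).
transitivity ((3 * x + 2) ^ 3 * ((x + 2) / 2) + t' * (3 * x + 2) ^ 3); [ ring | ].
rewrite <- Hrel; field.
Qed.

(** * The value of the continued fraction *)

Lemma Kfrac_eq_cf (x : C) (k n : nat) :
  Kfrac (fun m : nat => RtoC (kappa m))
        (fun m : nat => match m with O => x / 2 | S _ => x end) (S k) n
  = cf kappa x (S k) n 0.
Proof.
revert k; induction n as [ | n IH ]; intro k; [ reflexivity | ].
cbn [Kfrac cf]; now rewrite IH.
Qed.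

Definition kappa_cf (x : C) : C := x / 2 + Clim_seq (fun n => cf kappa x 1 n 0).

Lemma is_Clim_seq_kappa_cf (x : C) : (0 < Re x)%R ->
  is_Clim_seq (fun n => cf kappa x 1 n 0) (kappa_cf x - x / 2).
Proof.
intro Hx; destruct (cf_uniform_limit kappa x kappa_bounds Hx) as [t Ht].
assert (H : is_Clim_seq (fun n => cf kappa x 1 n 0) t).
{ apply Ht; exists 0%nat; intros; simpl; lra. }
unfold kappa_cf; rewrite (Clim_seq_eq _ _ H).
replace (x / 2 + t - x / 2) with t by ring; exact H.
Qed.

Lemma kappa_cf_functional (x : C) : (0 < Re x)%R ->
  (3 * x + 2) ^ 3 * kappa_cf (x + 2) = (3 * x + 4) ^ 3 * kappa_cf x.
Proof.
intro Hx.
assert (Hx2 : (0 < Re (x + 2))%R) by (rewrite re_plus, re_RtoC; lra).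
pose proof (kappa_cf_shift x _ _ Hx (is_Clim_seq_kappa_cf x Hx)
  (is_Clim_seq_kappa_cf (x + 2) Hx2)) as H.
replace ((x + 2) / 2 + (kappa_cf (x + 2) - (x + 2) / 2)) with (kappa_cf (x + 2)) in H by ring.
replace (x / 2 + (kappa_cf x - x / 2)) with (kappa_cf x) in H by ring.
exact H.
Qed.

Lemma kappa_cf_bound (x : C) : (0 < Re x)%R ->
  (Cmod (kappa_cf x - x / 2) <= kappa 1 / Re x)%R.
Proof.
intro Hx; pose proof (kappa_bounds 0) as Hk.
apply (is_lim_seq_le_loc (fun n => Cmod (cf kappa x 1 n 0)) (fun _ => kappa 1 / Re x)%R
  (Cmod (kappa_cf x - x / 2)) (kappa 1 / Re x)%R); [ | | apply is_lim_seq_const ].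
2: apply (is_lim_seq_lipschitz Cmod _ _ Cmod_lipschitz), is_Clim_seq_kappa_cf, Hx.
exists 1%nat; intros [ | n] Hn; [ lia | ]; cbn [cf].
assert (Hr : (Re x <= Re (x + cf kappa x 2 n 0))%R).
{ rewrite re_plus.
  pose proof (Re_cf_nonneg kappa x 1 n 0 ltac:(intro; left; apply kappa_bounds) Hx ltac:(simpl; lra)).
  lra. }
rewrite Cmod_div, Cmod_R, Rabs_pos_eq by (try apply Re_neq_0; lra).
apply Rmult_le_compat_l; [ lra | ]; apply Rinv_le_contravar; [ exact Hx | ].
eapply Rle_trans; [ exact Hr | ]; eapply Rle_trans; [ apply Rle_abs | apply re_le_Cmod ].
Qed.

Lemma kappa_cf_neq_0 (x : C) : (0 < Re x)%R -> kappa_cf x <> 0.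
Proof.
intros Hx H0.
assert (H : (0 <= Re (kappa_cf x - x / 2))%R).
{ apply (is_lim_seq_le_loc (fun _ => 0%R) (fun n => Re (cf kappa x 1 n 0))
    0%R (Re (kappa_cf x - x / 2))); [ | apply is_lim_seq_const | ].
  - exists 0%nat; intros n _; apply Re_cf_nonneg; [ | exact Hx | simpl; lra ].
    intro; left; apply kappa_bounds.
  - apply (is_lim_seq_lipschitz Re _ _ Re_lipschitz), is_Clim_seq_kappa_cf, Hx. }
rewrite H0 in H.
replace (0 - x / 2) with (RtoC (- / 2) * x) in H by (rewrite RtoC_opp, RtoC_inv by lra; field).
rewrite re_scal_l in H; lra.
Qed.

(** At [x + 2j] the factors [3x + 2] and [3x + 4] of the functional equation become six
    times [z + j] and [w + j], where [z] and [w] are the two arguments below, so that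
    iterating it builds rising factorials. *)
Lemma kappa_cf_rising (x : C) (n : nat) : (0 < Re x)%R ->
  rising (1 / 2 * (x + 2 / 3)) n ^ 3 * kappa_cf (x + 2 * INR n)
  = rising (1 / 2 * (x + 4 / 3)) n ^ 3 * kappa_cf x.
Proof.
intro Hx; induction n as [ | n IH ].
- simpl INR; replace (x + 2 * 0) with x by ring; reflexivity.
- cbn [rising]; set (z := 1 / 2 * (x + 2 / 3)) in *; set (w := 1 / 2 * (x + 4 / 3)) in *.
  assert (Hxn : (0 < Re (x + 2 * INR n))%R).
  { rewrite <- RtoC_mult, re_plus, re_RtoC; pose proof (pos_INR n); lra. }
  pose proof (kappa_cf_functional (x + 2 * INR n) Hxn) as H.
  replace (x + 2 * INR (S n)) with (x + 2 * INR n + 2) by (rewrite S_INR, RtoC_plus; ring).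
  replace (3 * (x + 2 * INR n) + 2) with (6 * (z + INR n)) in H by (unfold z; field).
  replace (3 * (x + 2 * INR n) + 4) with (6 * (w + INR n)) in H by (unfold w; field).
  transitivity (rising z n ^ 3 / 216 * ((6 * (z + INR n)) ^ 3 * kappa_cf (x + 2 * INR n + 2)));
    [ field | ].
  rewrite H.
  transitivity ((w + INR n) ^ 3 * (rising z n ^ 3 * kappa_cf (x + 2 * INR n))); [ field | ].
  rewrite IH; ring.
Qed.

Lemma Gamma_seq_quotient (x : C) (n : nat) : (0 < Re x)%R ->
  (Gamma_seq (1 / 2 * (x + 2 / 3)) (S n) / Gamma_seq (1 / 2 * (x + 4 / 3)) (S n)) ^ 3
  = kappa_cf (x + 2 * INR (S (S n))) / INR (S n) / kappa_cf x.
Proof.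
intro Hx; pose proof (kappa_cf_rising x (S (S n)) Hx) as H.
pose proof (kappa_cf_neq_0 x Hx) as HL.
unfold Gamma_seq.
assert (Hz : (0 < Re (1 / 2 * (x + 2 / 3)))%R) by (destruct x; simpl in *; lra).
assert (Hw : (0 < Re (1 / 2 * (x + 4 / 3)))%R) by (destruct x; simpl in *; lra).
pose proof (rising_neq_0 _ (S (S n)) Hz) as Hr.
pose proof (rising_neq_0 _ (S (S n)) Hw) as Hs.
set (l := RtoC (ln (INR (S n)))).
(* The exponents differ by l / 3, so the cubes differ by the factor exp l = n + 1. *)
assert (HE : Cexp (1 / 2 * (x + 4 / 3) * l) ^ 3 = Cexp (1 / 2 * (x + 2 / 3) * l) ^ 3 * INR (S n)).
{ rewrite !Cexp_pow.
  replace (RtoC (INR (S n))) with (Cexp l).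
  - rewrite <- Cexp_plus; f_equal; simpl INR; rewrite !RtoC_plus; field.
  - unfold l; rewrite Cexp_RtoC, exp_ln; [ reflexivity | apply lt_0_INR; lia ]. }
set (z := 1 / 2 * (x + 2 / 3)) in *; set (w := 1 / 2 * (x + 4 / 3)) in *.
pose proof (Cexp_neq_0 (w * l)) as Hew; pose proof (Cexp_neq_0 (z * l)) as Hez.
set (E := Cexp (z * l)) in *; set (F := Cexp (w * l)) in *.
set (r := rising z (S (S n))) in *; set (s := rising w (S (S n))) in *.
pose proof (INR_neq_0 n) as Hn.
assert (Hf : RtoC (INR (fact (S n))) <> 0)
  by (apply Re_neq_0; rewrite re_RtoC; apply INR_fact_lt_0).
transitivity (E ^ 3 * s ^ 3 / (F ^ 3 * r ^ 3)); [ field; auto | ].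
rewrite HE.
transitivity (s ^ 3 * kappa_cf x / (INR (S n) * r ^ 3 * kappa_cf x)); [ field; auto | ].
rewrite <- H; field; auto.
Qed.

Lemma is_Clim_seq_kappa_cf_asymptotic (x : C) : (0 < Re x)%R ->
  is_Clim_seq (fun n => kappa_cf (x + 2 * INR (S (S n))) / INR (S n)) 1.
Proof.
intro Hx; pose proof (kappa_bounds 0) as Hk.
set (K := (Cmod (x / 2 + 1) + kappa 1 / Re x)%R).
apply is_Clim_seq_le with (fun n => K * / INR (S n))%R.
- replace (Finite 0) with (Rbar_mult K 0) by (simpl; f_equal; ring).
  apply is_lim_seq_scal_l, is_lim_seq_inv_succ.
- exists 0%nat; intros n _.
  set (y := x + 2 * INR (S (S n))).
  assert (Hy : (Re x <= Re y)%R).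
  { unfold y; rewrite <- RtoC_mult, re_plus, re_RtoC; pose proof (pos_INR (S (S n))); lra. }
  replace (kappa_cf y / INR (S n) - 1)
    with ((x / 2 + 1 + (kappa_cf y - y / 2)) * RtoC (/ INR (S n))).
  + rewrite Cmod_mult, Cmod_R, Rabs_pos_eq
      by (left; apply Rinv_0_lt_compat, lt_0_INR; lia).
    apply Rmult_le_compat_r; [ left; apply Rinv_0_lt_compat, lt_0_INR; lia | ].
    eapply Rle_trans; [ apply Cmod_triangle | ]; apply Rplus_le_compat_l.
    eapply Rle_trans; [ apply kappa_cf_bound; lra | ].
    apply Rmult_le_compat_l; [ lra | ]; apply Rinv_le_contravar; lra.
  + pose proof (INR_neq_0 n) as Hn.
    rewrite RtoC_inv by (apply not_0_INR; lia).
    unfold y; rewrite (S_INR (S n)), RtoC_plus; field; exact Hn.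
Qed.

Theorem corollary1p7 (x : C) (hx : (0 < Re x)%R) :
  exists L : C,
    is_cfrac (fun m : nat => RtoC (kappa m))
             (fun m : nat => match m with O => x / 2 | S _ => x end) L /\
    L <> 0 /\
    Gamma (1 / 2 * (x + 2 / 3)) ^ 3 / Gamma (1 / 2 * (x + 4 / 3)) ^ 3 = 1 / L.
Proof.
exists (kappa_cf x); split; [ | split ].
- unfold is_cfrac.
  replace (kappa_cf x) with (x / 2 + (kappa_cf x - x / 2)) by ring.
  apply is_Clim_seq_ext_loc with (fun n => x / 2 + cf kappa x 1 n 0).
  + exists 0%nat; intros n _; now rewrite Kfrac_eq_cf.
  + apply is_Clim_seq_plus; [ apply is_Clim_seq_const | now apply is_Clim_seq_kappa_cf ].
- now apply kappa_cf_neq_0.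
- destruct (is_Clim_seq_Gamma (1 / 2 * (x + 2 / 3))) as [_ Hz].
  { destruct x; simpl in *; lra. }
  destruct (is_Clim_seq_Gamma (1 / 2 * (x + 4 / 3))) as [Hw0 Hw].
  { destruct x; simpl in *; lra. }
  set (z := 1 / 2 * (x + 2 / 3)) in *; set (w := 1 / 2 * (x + 4 / 3)) in *.
  pose proof (is_Clim_seq_mult _ _ _ _ Hz (is_Clim_seq_inv _ _ Hw0 Hw)) as Hq.
  pose proof (is_Clim_seq_mult _ _ _ _ Hq (is_Clim_seq_mult _ _ _ _ Hq Hq)) as Hc.
  apply is_Clim_seq_unique with (fun n => (Gamma_seq z (S n) / Gamma_seq w (S n)) ^ 3).
  + replace (Gamma z ^ 3 / Gamma w ^ 3)
      with (Gamma z * / Gamma w * (Gamma z * / Gamma w * (Gamma z * / Gamma w)))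
      by (field; exact Hw0).
    apply is_Clim_seq_ext_loc with (2 := is_Clim_seq_subseq _ _ S (eventually_subseq S ltac:(intro; lia)) Hc).
    exists 0%nat; intros n _; unfold Cdiv; ring.
  + apply is_Clim_seq_ext_loc with
      (fun n => kappa_cf (x + 2 * INR (S (S n))) / INR (S n) * / kappa_cf x).
    * exists 0%nat; intros n _; unfold z, w; now rewrite Gamma_seq_quotient.
    * apply is_Clim_seq_mult; [ now apply is_Clim_seq_kappa_cf_asymptotic | apply is_Clim_seq_const ].
Qed.
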